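(* Let $K$ be a complete discretely valued field with ring of integers $\mathcal{O}_K$, uniformiser $\pi$ and residue field $\mathbb{F}$, and let $\rho\colon G\to\mathrm{GL}(V)$ be an irreducible representation of a group $G$ on a finite-dimensional $K$-vector space $V$ admitting at least one $\rho(G)$-stable lattice. Let $\Lambda$ be a $\rho(G)$-stable lattice. Then the map $\theta_\Lambda\colon\mathcal{X}_{\max}(\rho)\to\mathrm{sharp}(\Lambda/\pi\Lambda)$ is surjective.
   Context: A lattice in $V$ is a free $\mathcal{O}_K$-submodule of rank $\dim_KV$, $\rho(G)$-stable if $\rho(g)\Lambda=\Lambda$ for all $g$. A stable lattice $\Lambda'$ is normalised at a nonzero $v\in V$ if $v\in\Lambda'$ and its image in $\Lambda'/\pi\Lambda'$ is nonzero; it is maximal with respect to $v$ if it is maximal under inclusion among stable lattices normalised at $v$; it is maximal if it is maximal with respect to some nonzero $v$. $\mathcal{X}_{\max}(\rho)$ is the set of homothety classes of maximal stable lattices. For a finite-dimensional $\mathbb{F}[G]$-module $\overline V$, a subquotient is a pair $V_1\subseteq V_2$ of subrepresentations; it is sharp if $V_2/V_1$ is irreducible and every subrepresentation $W\supsetneq V_1$ satisfies $W\supseteq V_2$; $\mathrm{sharp}(\overline V)$ denotes the set of sharp subquotients. For $x\in\mathcal{X}_{\max}(\rho)$, let $\Lambda_x$ be the representative of $x$ with $\Lambda\subseteq\Lambda_x$ and $\Lambda\not\subseteq\pi\Lambda_x$, let $\varphi\colon\Lambda/\pi\Lambda\to\Lambda_x/\pi\Lambda_x$ be induced by inclusion,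 and set $\theta_\Lambda(x)=(\ker\varphi,\varphi^{-1}(\mathrm{soc}(\Lambda_x/\pi\Lambda_x)))$; this is a sharp subquotient of $\Lambda/\pi\Lambda$. *)

(* Defs.v *)
From HB Require Import structures.
From mathcomp Require Import all_boot all_order all_algebra.
From mathcomp Require Import generic_quotient ring_quotient.
From mathcomp Require Import boolp classical_sets.

Set Implicit Arguments.
Unset Strict Implicit.
Unset Printing Implicit Defensive.

Import Order.TTheory GRing.Theory Num.Theory.

Local Open Scope ring_scope.
Local Open Scope classical_set_scope.
Local Open Scope quotient_scope.

#[local] Obligation Tactic := idtac.

(* A normalised discrete valuation.  Only the values at nonzero elements are
   meaningful: the convention v(0) = +oo is implemented by treating 0
   separately wherever v is used. *)
Record discrete_valuation (K : fieldType) := DiscreteValuation {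
  dval :> K -> int;
  dvalM : forall x y : K, x != 0 -> y != 0 -> dval (x * y) = dval x + dval y;
  dvalD : forall x y : K, x != 0 -> y != 0 -> x + y != 0 ->
    Order.min (dval x) (dval y) <= dval (x + y);
  dval_surj : exists2 x : K, x != 0 & dval x = 1
}.

Section Valuation.
Variables (K : fieldType) (v : discrete_valuation K).

Definition val_ge (n : int) (x : K) : bool := (x == 0) || (n <= v x).

Definition cauchy_seq (u : nat -> K) : Prop :=
  forall n : int, exists k : nat,
    forall i j : nat, (k <= i)%N -> (k <= j)%N -> val_ge n (u i - u j).

Definition converges_to (u : nat -> K) (l : K) : Prop :=
  forall n : int, exists k : nat,
    forall i : nat, (k <= i)%N -> val_ge n (u i - l).

Definition complete_valuation : Prop :=
  forall u : nat -> K, cauchy_seq u -> exists l : K, converges_to u l.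

Lemma dval1 : v 1 = 0.
Proof.
have := dvalM v (oner_neq0 K) (oner_neq0 K); rewrite mulr1 => h.
by apply: (addrI (v 1)); rewrite addr0 -h.
Qed.

Lemma dvalN1 : v (-1) = 0.
Proof.
have N1 : (-1 : K) != 0 by rewrite oppr_eq0 oner_neq0.
have := dvalM v N1 N1; rewrite mulrNN mulr1 dval1 => /esym/eqP.
by rewrite -mulr2n mulrn_eq0 => /eqP.
Qed.

Lemma dvalV x : x != 0 -> v x^-1 = - v x.
Proof.
move=> x0; have := dvalM v x0 (invr_neq0 x0).
by rewrite divff // dval1 => /esym/eqP; rewrite addrC addr_eq0 => /eqP.
Qed.

Lemma val_ge0 n : val_ge n 0. Proof. by rewrite /val_ge eqxx. Qed.

Lemma val_geM m n x y : val_ge m x -> val_ge n y -> val_ge (m + n) (x * y).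
Proof.
rewrite /val_ge mulf_eq0; have [//|x0] := eqVneq x 0; have [//|y0] := eqVneq y 0.
by move=> /= vx vy; rewrite dvalM // lerD.
Qed.

Lemma val_geD n x y : val_ge n x -> val_ge n y -> val_ge n (x + y).
Proof.
rewrite /val_ge; have [->|x0] := eqVneq x 0; first by rewrite add0r.
have [->|y0] := eqVneq y 0; first by rewrite addr0 (negPf x0).
have [//|xy0] := eqVneq (x + y) 0; move=> /= vx vy.
by apply: le_trans (dvalD v x0 y0 xy0); rewrite le_min vx.
Qed.

Lemma val_geN n x : val_ge n x -> val_ge n (- x).
Proof.
move=> vx; rewrite -mulN1r -[n]add0r val_geM //.
by rewrite /val_ge dvalN1 lexx orbT.
Qed.

Lemma val_geB n x y : val_ge n x -> val_ge n y -> val_ge n (x - y).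
Proof. by move=> vx vy; rewrite val_geD // val_geN. Qed.

Definition integer_pred : {pred K} := val_ge 0.

Lemma integer_subring : subring_closed integer_pred.
Proof.
split; first by rewrite unfold_in /val_ge dval1 lexx orbT.
- by move=> x y; apply: val_geB.
- by move=> x y vx vy; have := val_geM vx vy; rewrite addr0.
Qed.
HB.instance Definition _ :=
  GRing.isSubringClosed.Build K integer_pred integer_subring.

Definition integer_ring := {x : K | x \in integer_pred}.
HB.instance Definition _ := SubChoice.on integer_ring.
HB.instance Definition _ :=
  [SubChoice_isSubComNzRing of integer_ring by <:].

Definition max_ideal : {pred integer_ring} := fun x => val_ge 1 (\val x).

Lemma max_ideal_idealr : idealr_closed max_ideal.
Proof.
split; first by rewrite unfold_in /= val_ge0.
  by rewrite unfold_in /= /val_ge oner_eq0 dval1.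
move=> a x y vx vy; rewrite unfold_in /= val_geD //.
by have := val_geM (valP a) vx; rewrite add0r.
Qed.
HB.instance Definition _ :=
  isIdealr.Build integer_ring max_ideal max_ideal_idealr.

Definition residue_field := {ideal_quot max_ideal}.
HB.instance Definition _ := GRing.ComNzRing.on residue_field.

Definition residue (a : integer_ring) : residue_field := \pi a.

Lemma residueK (q : residue_field) : residue (repr q) = q.
Proof. exact: reprK. Qed.

Lemma residue_zmod : zmod_morphism residue.
Proof. exact: raddfB. Qed.
Lemma residue_monoid : monoid_morphism residue.
Proof. by split; [exact: rmorph1|exact: rmorphM]. Qed.
HB.instance Definition _ := GRing.isZmodMorphism.Build
  integer_ring residue_field residue residue_zmod.
HB.instance Definition _ := GRing.isMonoidMorphism.Build
  integer_ring residue_field residue residue_monoid.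

Lemma residue_eq0 a : (residue a == 0) = (a \in max_ideal).
Proof. by rewrite -(rmorph0 residue) -Quotient.idealrBE subr0. Qed.

Definition residue_inv (q : residue_field) : residue_field :=
  if q == 0 then 0
  else residue (insubd 0 (\val (repr q : integer_ring))^-1).

Lemma residue_mulVf (q : residue_field) : q != 0 -> residue_inv q * q = 1.
Proof.
move=> q0; rewrite /residue_inv (negPf q0); move: q0.
rewrite -{1 3}[q]residueK residue_eq0; set a : integer_ring := repr q.
rewrite unfold_in /val_ge negb_or -ltNge => /andP[a0 va].
have va0 : v (\val a) = 0.
  apply/eqP; rewrite eq_le; apply/andP; split; first by rewrite -ltzD1.
  by have := valP a; rewrite unfold_in /val_ge (negPf a0).
rewrite -rmorphM -[RHS](rmorph1 residue); congr residue.
apply/val_inj; rewrite /= insubdK ?mulVf //; change (val_ge 0 (\val a)^-1).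
by rewrite /val_ge dvalV // va0 oppr0 lexx orbT.
Qed.

Lemma residue_inv0 : residue_inv 0 = 0.
Proof. by rewrite /residue_inv eqxx. Qed.

HB.instance Definition _ := GRing.ComNzRing_isField.Build residue_field
  residue_mulVf residue_inv0.

Record uniformiser := Uniformiser {
  unif :> K;
  unif_neq0 : unif != 0;
  dval_unif : v unif = 1
}.

Lemma unif_integer (p : uniformiser) : (p : K) \in integer_pred.
Proof. by rewrite unfold_in /val_ge dval_unif orbT. Qed.

Definition unif_int (p : uniformiser) : integer_ring := 
  Sub (p : K) (unif_integer p).

Lemma max_idealP (p : uniformiser) (a : integer_ring) :
  a \in max_ideal -> exists b : integer_ring, a = unif_int p * b.
Proof.
move=> va; have vb : (p : K)^-1 * \val a \in integer_pred.
  apply: (@val_geM (-1) 1) => //.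
  by rewrite /val_ge dvalV ?unif_neq0 // dval_unif lexx orbT.
by exists (Sub ((p : K)^-1 * \val a) vb); apply/val_inj; rewrite /= mulVKf ?unif_neq0.
Qed.

End Valuation.

Arguments integer_pred {K} v.
Arguments max_ideal {K} v.

Record representation (G : groupType) (R : pzRingType) (M : lmodType R) :=
  Representation {
    rep_fun :> G -> {linear M -> M};
    rep1 : forall x, rep_fun 1%g x = x;
    repM : forall g h x, rep_fun (g * h)%g x = rep_fun g (rep_fun h x)
  }.

Record subrepresentation (G : groupType) (R : pzRingType) (M : lmodType R)
    (r : representation G M) := Subrepresentation {
  subrep_set :> set M;
  subrep0 : subrep_set 0;
  subrepD : forall x y, subrep_set x -> subrep_set y -> subrep_set (x + y);
  subrepZ : forall a x, subrep_set x -> subrep_set (a *: x);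
  subrepG : forall g x, subrep_set x -> subrep_set (r g x)
}.

Definition irreducible (G : groupType) (R : pzRingType) (M : lmodType R)
    (r : representation G M) : Prop :=
  (exists x : M, x != 0) /\
  forall W : subrepresentation r,
    (W : set M) = [set 0] \/ (W : set M) = setT.

Section Sub.
Variables (G : groupType) (R : pzRingType) (M : lmodType R).
Variables (r : representation G M) (W : subrepresentation r).

Definition subrep_pred : {pred M} := fun x => `[< subrep_set W x >].

Lemma subrep_submod : submod_closed subrep_pred.
Proof.
split; first by apply/asboolP; apply: subrep0.
move=> a x y /asboolP Wx /asboolP Wy; apply/asboolP.
by apply: subrepD => //; apply: subrepZ.
Qed.
HB.instance Definition _ :=
  GRing.isSubmodClosed.Build R M subrep_pred subrep_submod.

Definition subrep_type := {x : M | x \in subrep_pred}.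
HB.instance Definition _ := SubChoice.on subrep_type.
HB.instance Definition _ := [SubChoice_isSubLmodule of subrep_type by <:].

Lemma subrep_act_subproof g (x : subrep_type) : r g (\val x) \in subrep_pred.
Proof. by apply/asboolP/subrepG/asboolP; apply: valP x. Qed.

Definition subrep_act g (x : subrep_type) : subrep_type :=
  Sub (r g (\val x)) (subrep_act_subproof g x).

Lemma subrep_act_linear g : linear (subrep_act g).
Proof. by move=> a x y; apply/val_inj; rewrite /= linearP. Qed.
HB.instance Definition _ g := GRing.isLinear.Build R subrep_type subrep_type
  *:%R (subrep_act g) (subrep_act_linear g).

Program Definition sub_rep : representation G subrep_type :=
  @Representation _ _ _ (fun g => subrep_act g) _ _.
Next Obligation. by move=> x; apply/val_inj; rewrite /= rep1. Qed.
Next Obligation. by move=> g h x; apply/val_inj; rewrite /= repM. Qed.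

End Sub.

Section Quo.
Variables (G : groupType) (R : pzRingType) (M : lmodType R).
Variables (r : representation G M) (W : subrepresentation r).

Definition quorep_type := Quotient.quot (subrep_pred W).
HB.instance Definition _ := GRing.Zmodule.on quorep_type.

Definition quorep_pi (x : M) : quorep_type := \pi x.

Lemma quorep_piK (q : quorep_type) : quorep_pi (repr q) = q.
Proof. exact: reprK. Qed.

Lemma quorep_piE x y : quorep_pi x = quorep_pi y <-> subrep_set W (x - y).
Proof.
by split=> [/eqP|h]; [|apply/eqP]; rewrite /quorep_pi -Quotient.idealrBE;
  [move/asboolP|apply/asboolP].
Qed.

Lemma quorep_pi_zmod : zmod_morphism quorep_pi.
Proof. by move=> x y; rewrite /quorep_pi raddfB. Qed.
HB.instance Definition _ :=
  GRing.isZmodMorphism.Build M quorep_type quorep_pi quorep_pi_zmod.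

Definition quorep_scale (a : R) (q : quorep_type) : quorep_type :=
  quorep_pi (a *: repr q).

Lemma quorep_scaleE a x : quorep_scale a (quorep_pi x) = quorep_pi (a *: x).
Proof.
apply/quorep_piE; rewrite -scalerBr; apply: subrepZ.
by apply/quorep_piE; rewrite quorep_piK.
Qed.

Fact quorep_scaleA a b q :
  quorep_scale a (quorep_scale b q) = quorep_scale (a * b) q.
Proof. by rewrite -[q]quorep_piK !quorep_scaleE scalerA. Qed.
Fact quorep_scale1 : left_id 1 quorep_scale.
Proof. by move=> q; rewrite -[q]quorep_piK !quorep_scaleE scale1r. Qed.
Fact quorep_scaleDr : right_distributive quorep_scale +%R.
Proof.
move=> a p q; rewrite -[p]quorep_piK -[q]quorep_piK.
by rewrite -raddfD !quorep_scaleE -raddfD scalerDr.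
Qed.
Fact quorep_scaleDl q : {morph quorep_scale^~ q : a b / a + b}.
Proof.
by move=> a b; rewrite -[q]quorep_piK !quorep_scaleE scalerDl raddfD.
Qed.
HB.instance Definition _ := GRing.Zmodule_isLmodule.Build R quorep_type
  quorep_scaleA quorep_scale1 quorep_scaleDr quorep_scaleDl.

Definition quorep_act g (q : quorep_type) : quorep_type :=
  quorep_pi (r g (repr q)).

Lemma quorep_actE g x : quorep_act g (quorep_pi x) = quorep_pi (r g x).
Proof.
apply/quorep_piE; rewrite -linearB; apply: subrepG.
by apply/quorep_piE; rewrite quorep_piK.
Qed.

Lemma quorep_act_linear g : linear (quorep_act g).
Proof.
move=> a p q; rewrite -[p]quorep_piK -[q]quorep_piK.
have sE b x : b *: quorep_pi x = quorep_pi (b *: x) by apply: quorep_scaleE.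
by rewrite sE -raddfD !quorep_actE sE -raddfD linearP.
Qed.
HB.instance Definition _ g := GRing.isLinear.Build R quorep_type quorep_type
  *:%R (quorep_act g) (quorep_act_linear g).

Program Definition quo_rep : representation G quorep_type :=
  @Representation _ _ _ (fun g => quorep_act g) _ _.
Next Obligation. by move=> q; rewrite -[q]quorep_piK /= quorep_actE rep1. Qed.
Next Obligation.
by move=> g h q; rewrite -[q]quorep_piK /= !quorep_actE repM.
Qed.

End Quo.

Section Socle.
Variables (G : groupType) (R : pzRingType) (M : lmodType R).
Variable r : representation G M.

(* W2 / W1, formed as the quotient of W2 by W1 `&` W2 so that it makes sense
   for arbitrary W1 and W2. *)
Program Definition subrep_in (W1 W2 : subrepresentation r) :
    subrepresentation (sub_rep W2) :=
  @Subrepresentation _ _ _ _ [set x | subrep_set W1 (\val x)] _ _ _ _.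
Next Obligation. by move=> W1 W2; apply: subrep0. Qed.
Next Obligation. by move=> W1 W2 x y; apply: subrepD. Qed.
Next Obligation. by move=> W1 W2 a x; apply: subrepZ. Qed.
Next Obligation. by move=> W1 W2 g x; apply: subrepG. Qed.

Definition subquotient_rep (W1 W2 : subrepresentation r) :=
  quo_rep (subrep_in W1 W2).

Definition is_subquotient (s : subrepresentation r * subrepresentation r) :=
  (s.1 : set M) `<=` s.2.

Definition sharp : set (subrepresentation r * subrepresentation r) :=
  [set s | [/\ is_subquotient s,
               irreducible (subquotient_rep s.1 s.2)
             & forall W : subrepresentation r,
                 (s.1 : set M) `<` W -> (s.2 : set M) `<=` W]].

Definition socle_set : set M :=
  [set x | exists n (S : 'I_n -> subrepresentation r) (y : 'I_n -> M),
     (forall i, irreducible (sub_rep (S i)) /\ subrep_set (S i) (y i)) /\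
     x = \sum_(i < n) y i].

Program Definition socle : subrepresentation r :=
  @Subrepresentation _ _ _ _ socle_set _ _ _ _.
Next Obligation.
exists 0%N, (fun=> Subrepresentation (subrep_set := setT) I
  (fun _ _ _ _ => I) (fun _ _ _ => I) (fun _ _ _ => I)), (fun=> 0).
by split; [case|rewrite big_ord0].
Qed.
Next Obligation.
move=> x y [m [S [a [Sa ->]]]] [n [T [b [Tb ->]]]].
exists (m + n)%N.
exists (fun i => match fintype.split i with inl j => S j | inr j => T j end).
exists (fun i => match fintype.split i with inl j => a j | inr j => b j end).
split; first by move=> i; case: (fintype.split i).
rewrite big_split_ord /=; congr (_ + _); apply: eq_bigr => i _.
  by case: splitP => j /= e; [congr a; apply: val_inj|
    have := ltn_ord i; rewrite e ltnNge leq_addr].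
case: splitP => j /= e; last by congr b; apply/val_inj/(@addnI m).
by have := ltn_ord j; rewrite -e ltnNge leq_addr.
Qed.
Next Obligation.
move=> a x [n [S [y [Sy ->]]]]; exists n, S, (fun i => a *: y i).
split; last exact: scaler_sumr.
by move=> i; have [? ?] := Sy i; split=> //; apply: subrepZ.
Qed.
Next Obligation.
move=> g x [n [S [y [Sy ->]]]]; exists n, S, (fun i => r g (y i)).
split; last exact: linear_sum.
by move=> i; have [? ?] := Sy i; split=> //; apply: subrepG.
Qed.

End Socle.

Arguments sharp {G R M} r.

Record intertwiner (G : groupType) (R : pzRingType) (M N : lmodType R)
    (r : representation G M) (s : representation G N) := Intertwiner {
  inter_fun :> {linear M -> N};
  interG : forall g x, inter_fun (r g x) = s g (inter_fun x)
}.

Section Intertwiner.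
Variables (G : groupType) (R : pzRingType) (M N : lmodType R).
Variables (r : representation G M) (s : representation G N).
Variable f : intertwiner r s.

Program Definition inter_preim (W : subrepresentation s) : subrepresentation r :=
  @Subrepresentation _ _ _ _ (f @^-1` W) _ _ _ _.
Next Obligation. by move=> W; rewrite /= linear0; apply: subrep0. Qed.
Next Obligation. by move=> W x y Wx Wy; rewrite /= linearD; apply: subrepD. Qed.
Next Obligation. by move=> W a x Wx; rewrite /= linearZ; apply: subrepZ. Qed.
Next Obligation. by move=> W g x Wx; rewrite /= interG; apply: subrepG. Qed.

Program Definition inter_ker : subrepresentation r :=
  @Subrepresentation _ _ _ _ [set x | f x = 0] _ _ _ _.
Next Obligation. exact: linear0. Qed.
Next Obligation. by move=> x y /= fx fy; rewrite linearD fx fy addr0. Qed.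
Next Obligation. by move=> a x /= fx; rewrite linearZ /= fx scaler0. Qed.
Next Obligation. by move=> g x /= fx; rewrite interG fx linear0. Qed.

End Intertwiner.

Section Reduction.
Variables (K : fieldType) (v : discrete_valuation K) (p : uniformiser v).

Section Module.
Variable M : lmodType (integer_ring v).

Definition unif_mul_pred : {pred M} :=
  fun x => `[< exists y : M, x = unif_int p *: y >].

Lemma unif_mul_zmod : zmod_closed unif_mul_pred.
Proof.
split; first by apply/asboolP; exists 0; rewrite scaler0.
move=> _ _ /asboolP[x ->] /asboolP[y ->]; apply/asboolP.
by exists (x - y); rewrite scalerBr.
Qed.
HB.instance Definition _ :=
  GRing.isZmodClosed.Build M unif_mul_pred unif_mul_zmod.

Definition reduction := Quotient.quot unif_mul_pred.
HB.instance Definition _ := GRing.Zmodule.on reduction.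

Definition red (x : M) : reduction := \pi x.

Lemma redK (q : reduction) : red (repr q) = q. Proof. exact: reprK. Qed.

Lemma redE x y : red x = red y <-> exists z, x - y = unif_int p *: z.
Proof.
by split=> [/eqP|h]; [|apply/eqP]; rewrite /red -Quotient.idealrBE;
  [move/asboolP|apply/asboolP].
Qed.

Lemma red_zmod : zmod_morphism red.
Proof. by move=> x y; rewrite /red raddfB. Qed.
HB.instance Definition _ :=
  GRing.isZmodMorphism.Build M reduction red red_zmod.

Definition red_scale (a : residue_field v) (q : reduction) : reduction :=
  red ((repr a : integer_ring v) *: repr q).

Lemma red_scaleE (a : integer_ring v) x :
  red_scale (residue a) (red x) = red (a *: x).
Proof.
rewrite /red_scale; set b := repr _; set y := repr _.
have [c bc] : exists c, b - a = unif_int p * c.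
  by apply: max_idealP; rewrite -residue_eq0 rmorphB /= residueK subrr.
have [z yz] : exists z, y - x = unif_int p *: z by apply/redE; rewrite redK.
apply/redE; exists (c *: y + a *: z).
rewrite scalerDr scalerA -bc scalerA [_ * a]mulrC -scalerA -yz.
by rewrite scalerBl scalerBr addrA subrK.
Qed.

Fact red_scaleA a b q : red_scale a (red_scale b q) = red_scale (a * b) q.
Proof.
by rewrite -[q]redK -[a]residueK -[b]residueK -rmorphM !red_scaleE scalerA.
Qed.
Fact red_scale1 : left_id 1 red_scale.
Proof.
by move=> q; rewrite -[q]redK -(rmorph1 (@residue _ v)) red_scaleE scale1r.
Qed.
Fact red_scaleDr : right_distributive red_scale +%R.
Proof.
move=> a x y; rewrite -[x]redK -[y]redK -[a]residueK.
by rewrite -raddfD !red_scaleE -raddfD scalerDr.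
Qed.
Fact red_scaleDl q : {morph red_scale^~ q : a b / a + b}.
Proof.
move=> a b; rewrite -[q]redK -[a]residueK -[b]residueK -rmorphD !red_scaleE.
by rewrite scalerDl raddfD.
Qed.
HB.instance Definition _ :=
  GRing.Zmodule_isLmodule.Build (residue_field v) reduction
    red_scaleA red_scale1 red_scaleDr red_scaleDl.

End Module.

Section Map.
Variables (M N : lmodType (integer_ring v)) (f : {linear M -> N}).

Definition red_map (q : reduction M) : reduction N := red (f (repr q)).

Lemma red_mapE x : red_map (red x) = red (f x).
Proof.
have [z xz] : exists z, repr (red x) - x = unif_int p *: z.
  by apply/redE; rewrite redK.
by apply/redE; exists (f z); rewrite -linearB xz linearZ.
Qed.

Lemma red_map_linear : linear red_map.
Proof.
move=> a x y; rewrite -[x]redK -[y]redK -[a]residueK.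
have sE (L : lmodType (integer_ring v)) b (z : L) :
  residue b *: red z = red (b *: z) by apply: red_scaleE.
by rewrite sE -raddfD !red_mapE sE -raddfD linearP.
Qed.
HB.instance Definition _ := GRing.isLinear.Build (residue_field v)
  (reduction M) (reduction N) *:%R red_map red_map_linear.

End Map.

Program Definition red_rep (G : groupType) (M : lmodType (integer_ring v))
    (r : representation G M) : representation G (reduction M) :=
  @Representation _ _ _ (fun g => red_map (r g)) _ _.
Next Obligation. by move=> G M r x; rewrite -[x]redK /= red_mapE rep1. Qed.
Next Obligation. by move=> G M r g h x; rewrite -[x]redK /= !red_mapE repM. Qed.

Program Definition red_inter (G : groupType) (M N : lmodType (integer_ring v))
    (r : representation G M) (s : representation G N) (f : intertwiner r s) :
    intertwiner (red_rep r) (red_rep s) :=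
  @Intertwiner _ _ _ _ _ _ (red_map f) _.
Next Obligation. by move=> G M N r s f g x; rewrite -[x]redK /= !red_mapE interG. Qed.

End Reduction.

Definition restr (K : fieldType) (v : discrete_valuation K) (V : lmodType K)
  : Type := V.

Section Restr.
Variables (K : fieldType) (v : discrete_valuation K) (V : lmodType K).

HB.instance Definition _ := GRing.Zmodule.on (restr v V).

Definition restr_scale (a : integer_ring v) (x : restr v V) : restr v V :=
  (\val a : K) *: (x : V).

Fact restr_scaleA a b x :
  restr_scale a (restr_scale b x) = restr_scale (a * b) x.
Proof. exact: scalerA. Qed.
Fact restr_scale1 : left_id 1 restr_scale.
Proof. by move=> x; apply: scale1r. Qed.
Fact restr_scaleDr : right_distributive restr_scale +%R.
Proof. by move=> a x y; apply: scalerDr. Qed.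
Fact restr_scaleDl x : {morph restr_scale^~ x : a b / a + b}.
Proof. by move=> a b; apply: scalerDl. Qed.
HB.instance Definition _ :=
  GRing.Zmodule_isLmodule.Build (integer_ring v) (restr v V)
    restr_scaleA restr_scale1 restr_scaleDr restr_scaleDl.

Variables (G : groupType) (rho : representation G V).

Definition restr_act (g : G) (x : restr v V) : restr v V := rho g x.

Lemma restr_act_linear g : linear (restr_act g).
Proof. by move=> a x y; apply: (linearP (rho g) (\val a : K)). Qed.
HB.instance Definition _ g :=
  GRing.isLinear.Build (integer_ring v) (restr v V) (restr v V) *:%R
    (restr_act g) (restr_act_linear g).

Program Definition restr_rep : representation G (restr v V) :=
  @Representation _ _ _ (fun g => restr_act g) _ _.
Next Obligation. by move=> x; apply: (rep1 rho). Qed.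
Next Obligation. by move=> g h x; apply: (repM rho). Qed.

End Restr.

Section Lattices.
Variables (K : fieldType) (v : discrete_valuation K) (p : uniformiser v).
Variables (V : vectType K) (G : groupType) (rho : representation G V).

Definition is_lattice (L : set V) : Prop :=
  exists e : 'I_(\dim {:V}) -> restr v V,
    (forall c : 'I_(\dim {:V}) -> integer_ring v,
       \sum_i c i *: e i = 0 -> forall i, c i = 0) /\
    L = [set x | exists c : 'I_(\dim {:V}) -> integer_ring v,
                   x = \sum_i c i *: e i].

Record stable_lattice := StableLattice {
  lat :> set V;
  lat_is_lattice : is_lattice lat;
  lat_stable : forall g : G, rho g @` lat = lat
}.
HB.instance Definition _ := gen_eqMixin stable_lattice.
HB.instance Definition _ := gen_choiceMixin stable_lattice.

Program Definition lat_subrep (L : stable_lattice) :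
    subrepresentation (restr_rep v rho) :=
  @Subrepresentation _ _ _ _ (lat L : set (restr v V)) _ _ _ _.
Next Obligation.
move=> L; have [e [_ ->]] := lat_is_lattice L; exists (fun=> 0).
by rewrite big1 // => i _; rewrite scale0r.
Qed.
Next Obligation.
move=> L x y; have [e [_ ->]] := lat_is_lattice L => -[a ->] [b ->].
exists (fun i => a i + b i); rewrite -big_split /=.
by apply: eq_bigr => i _; rewrite scalerDl.
Qed.
Next Obligation.
move=> L a x; have [e [_ ->]] := lat_is_lattice L => -[b ->].
exists (fun i => a * b i); rewrite scaler_sumr.
by apply: eq_bigr => i _; rewrite scalerA.
Qed.
Next Obligation. by move=> L g x Lx; rewrite -(lat_stable L g); exists x. Qed.

Definition lat_type (L : stable_lattice) := subrep_type (lat_subrep L).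
HB.instance Definition _ L := GRing.Lmodule.on (lat_type L).

Definition lat_rep (L : stable_lattice) : representation G (lat_type L) :=
  sub_rep (lat_subrep L).

Definition lat_mod (L : stable_lattice) : lmodType (residue_field v) :=
  reduction p (lat_type L).

Definition lat_mod_rep (L : stable_lattice) :
  representation G (lat_mod L) := red_rep p (lat_rep L).

Section Inclusion.
Variables (L M : stable_lattice) (LM : (L : set V) `<=` M).

Lemma lat_incl_subproof (x : lat_type L) :
  \val x \in subrep_pred (lat_subrep M).
Proof. by apply/asboolP/LM/asboolP; apply: valP x. Qed.

Definition lat_incl_fun (x : lat_type L) : lat_type M :=
  Sub (\val x) (lat_incl_subproof x).

Lemma lat_incl_linear : linear lat_incl_fun.
Proof. by move=> a x y; apply/val_inj. Qed.
HB.instance Definition _ := GRing.isLinear.Build (integer_ring v)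
  (lat_type L) (lat_type M) *:%R lat_incl_fun lat_incl_linear.

Program Definition lat_incl : intertwiner (lat_rep L) (lat_rep M) :=
  @Intertwiner _ _ _ _ _ _ lat_incl_fun _.
Next Obligation. by move=> g x; apply/val_inj. Qed.

Definition lat_mod_incl : intertwiner (lat_mod_rep L) (lat_mod_rep M) :=
  red_inter p lat_incl.

End Inclusion.

Definition normalised (L : stable_lattice) (w : V) : Prop :=
  exists x : lat_type L, \val x = w /\ red p x != 0.

Definition maximal_wrt (w : V) (L : stable_lattice) : Prop :=
  normalised L w /\
  forall M : stable_lattice, normalised M w ->
    (L : set V) `<=` M -> (M : set V) = L.

Definition maximal (L : stable_lattice) : Prop :=
  exists w : V, w != 0 /\ maximal_wrt w L.

Definition dilate (c : K) (L : set V) : set V := [set c *: x | x in L].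

Definition homothety_class (L : stable_lattice) : set stable_lattice :=
  [set M | exists c : K, c != 0 /\ (M : set V) = dilate c L].

Definition Xmax : set (set stable_lattice) := homothety_class @` maximal.

Lemma integer_predE (a : K) : a \in integer_pred v -> exists b : integer_ring v, \val b = a.
Proof. by move=> Oa; exists (Sub a Oa). Qed.

Lemma min_scale (I : finType) (c : I -> K) (i0 : I) : c i0 != 0 ->
  exists2 i, c i != 0 & forall j, c j / c i \in integer_pred v.
Proof.
move=> c0; have [i ci0 min] := @arg_minP _ _ _ i0 (fun i => c i != 0) (fun i => v (c i)) c0.
exists i => // j; rewrite unfold_in /integer_pred /val_ge mulf_eq0 invr_eq0 (negPf ci0) orbF.
have [//|cj0 /=] := eqVneq (c j) 0.
by rewrite dvalM ?invr_eq0 // dvalV // subr_ge0 min.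
Qed.

Local Notation n := (\dim {:V}).

Lemma lattice_free (e : 'I_n -> V) :
  (forall c : 'I_n -> integer_ring v,
     \sum_i c i *: (e i : restr v V) = 0 -> forall i, c i = 0) ->
  forall c : 'I_n -> K, \sum_i c i *: e i = 0 -> forall i, c i = 0.
Proof.
move=> free_e c ce0 i; apply/eqP/negPn/negP => ci0.
have [j cj0 Oc] := min_scale ci0.
have /choice[b bE] : forall k, exists x : integer_ring v, \val x = c k / c j.
  by move=> k; apply: integer_predE.
have /free_e/(_ j) bj0 : \sum_k b k *: (e k : restr v V) = 0.
  transitivity ((c j)^-1 *: \sum_k c k *: e k); last by rewrite ce0 scaler0.
  rewrite scaler_sumr; apply: eq_bigr => k _.
  by rewrite scalerA mulrC -bE.
by have := bE j; rewrite bj0 divff //= => /esym/eqP; rewrite oner_eq0.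
Qed.

Lemma lattice_coord (e : 'I_n -> V) :
  (forall c : 'I_n -> K, \sum_i c i *: e i = 0 -> forall i, c i = 0) ->
  forall x : V, exists c : 'I_n -> K, x = \sum_i c i *: e i.
Proof.
move=> free_e x; pose X := [tuple e i | i < n].
have XE (i : 'I_n) : X`_i = e i by rewrite -tnth_nth tnth_mktuple.
have fX : free X.
  apply/freeP => c; under eq_bigr do rewrite XE; exact: free_e.
have bX : basis_of {:V} X by rewrite basisEfree fX subvf size_tuple /=.
exists (fun i => coord X i x); rewrite {1}(coord_basis bX (memvf x)).
by apply: eq_bigr => i _; rewrite XE.
Qed.

Lemma dilate_is_lattice (c : K) (L : set V) : c != 0 ->
  is_lattice L -> is_lattice (dilate c L).
Proof.
move=> c0 [e [free_e ->]]; exists (fun i => c *: (e i : V) : V).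
have scE (b : 'I_n -> integer_ring v) :
    \sum_i b i *: ((c *: (e i : V) : V) : restr v V) = c *: (\sum_i b i *: e i : V).
  rewrite scaler_sumr; apply: eq_bigr => i _.
  by rewrite scalerA mulrC -scalerA.
split=> [b|].
  by rewrite scE => /eqP; rewrite scaler_eq0 (negPf c0) => /eqP; apply: free_e.
apply/seteqP; split=> [_ [_ [b ->] <-]|x [b ->]]; first by exists b; rewrite scE.
by exists (\sum_i b i *: e i); [exists b|rewrite scE].
Qed.

Program Definition dilate_lattice (c : K) (c0 : c != 0) (L : stable_lattice) :
  stable_lattice := @StableLattice (dilate c L) _ _.
Next Obligation.
by move=> c c0 L; apply: dilate_is_lattice => //; apply: lat_is_lattice.
Qed.
Next Obligation.
move=> c c0 L g; rewrite -{2}(lat_stable L g); apply/seteqP; split.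
  by move=> _ [_ [x Lx <-] <-]; rewrite linearZ; exists (rho g x) => //; exists x.
move=> _ [_ [x Lx <-] <-]; exists (c *: x); last by rewrite linearZ.
by exists x.
Qed.

Lemma stable_lattice_eq (L M : stable_lattice) : (L : set V) = M -> L = M.
Proof.
case: L M => [L L1 L2] [M M1 M2] /= LM; subst M.
by congr StableLattice; apply: Prop_irrelevance.
Qed.

Lemma latZ (L : stable_lattice) (a : K) x : a \in integer_pred v ->
  lat L x -> lat L (a *: x).
Proof.
move=> /integer_predE[b <-] Lx.
exact: (@subrepZ _ _ _ _ (lat_subrep L) b x Lx).
Qed.

Lemma class_rep_ex (L M : stable_lattice) : (exists w : V, w != 0) ->
  exists N, [/\ homothety_class M N, (L : set V) `<=` N
                    & ~ ((L : set V) `<=` dilate p N)].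
Proof.
move=> [w w0].
have [f [free_f LE]] := lat_is_lattice L.
have [e [free_e ME]] := lat_is_lattice M.
have Kf := lattice_free free_f; have Ke := lattice_free free_e.
have /choice[a aE] : forall j, exists c : 'I_n -> K,
    f j = \sum_i c i *: (e i : V).
  by move=> j; apply: lattice_coord.
have [[j0 i0] aji0] : exists ji, a ji.1 ji.2 != 0.
  apply: contrapT => a0; move/eqP: w0; apply.
  have [c ->] := lattice_coord Kf w; apply: big1 => j _.
  rewrite aE big1 ?scaler0 // => i _; apply/eqP; rewrite scaler_eq0.
  by apply/orP; left; apply/negPn/negP => aji; apply: a0; exists (j, i).
have [[j i] /= aji Oa] := @min_scale _ (fun ji => a ji.1 ji.2) (j0, i0) aji0.
exists (dilate_lattice aji M); split; first by exists (a j i).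
  have Lf k : lat (dilate_lattice aji M) (f k).
    have /choice[b bE] : forall l, exists x : integer_ring v,
        \val x = a k l / a j i.
      by move=> l; apply: integer_predE (Oa (k, l)).
    exists (\sum_l b l *: e l); first by rewrite ME; exists b.
    rewrite aE scaler_sumr; apply: eq_bigr => l _.
    by rewrite scalerA bE mulrC divfK.
  move=> x; rewrite LE => -[c ->].
  apply: (big_ind (fun y : V => lat (dilate_lattice aji M) y)).
  - exact: (subrep0 (lat_subrep (dilate_lattice aji M))).
  - exact: (@subrepD _ _ _ _ (lat_subrep (dilate_lattice aji M))).
  - move=> k _; apply: (@subrepZ _ _ _ _ (lat_subrep (dilate_lattice aji M))).
    exact: Lf.
move=> /(_ (f j)) [].
  rewrite LE; exists (fun k => (k == j)%:R); rewrite (bigD1 j) //= eqxx scale1r.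
  by rewrite big1 ?addr0 // => k /negPf->; rewrite scale0r.
move=> _ [x + <-]; rewrite ME => -[b ->].
rewrite aE => /esym/eqP; rewrite -subr_eq0 !scaler_sumr -sumrB => /eqP h.
have /Ke/(_ i)/eqP : \sum_l (a j l - (p : K) * (a j i * \val (b l))) *: (e l : V) = 0.
  rewrite -[RHS]h; apply: eq_bigr => l _.
  by rewrite scalerBl -!scalerA.
rewrite mulrCA -{1}[a j i]mulr1 -mulrBr mulf_eq0 (negPf aji) subr_eq0 => /eqP/esym pb1.
have: val_ge v 1 ((p : K) * \val (b i)).
  rewrite -[1]addr0; apply: val_geM (valP (b i)).
  by rewrite /val_ge dval_unif lexx orbT.
by rewrite pb1 /val_ge oner_eq0 dval1.
Qed.

Lemma dilateS (c : K) (L : stable_lattice) : c \in integer_pred v ->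
  dilate c L `<=` L.
Proof. by move=> Oc _ [x Lx <-]; apply: latZ. Qed.

Lemma dilateM (c d : K) (L : set V) : dilate c (dilate d L) = dilate (c * d) L.
Proof.
apply/seteqP; split=> [_ [_ [x Lx <-] <-]|_ [x Lx <-]].
  by exists x; rewrite ?scalerA.
by rewrite -scalerA; exists (d *: x) => //; exists x.
Qed.

Lemma class_rep_uniq (L M N : stable_lattice) : homothety_class M N ->
  (L : set V) `<=` M -> ~ ((L : set V) `<=` dilate p M) ->
  (L : set V) `<=` N -> ~ ((L : set V) `<=` dilate p N) -> M = N.
Proof.
move=> [d [d0 NE]] LM LpM LN LpN; apply: stable_lattice_eq.
have p0 := unif_neq0 p.
have subM (a : K) : val_ge v 1 a -> dilate a M `<=` dilate p M.
  move=> va; rewrite -[a](mulVKf p0) -dilateM => _ [x Mx <-]; exists x => //.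
  apply: dilateS Mx; apply: (@val_geM _ v (-1) 1) => //.
  by rewrite /val_ge dvalV // dval_unif lexx orbT.
have vd0 : v d = 0.
  apply/eqP; rewrite eq_le -!ltzD1; apply/andP; split; rewrite ltNge; apply/negP => vd.
    by apply: LpM; apply: subset_trans LN _; rewrite NE; apply: subM;
      rewrite /val_ge vd orbT.
  apply: LpN; apply: subset_trans LM _; rewrite NE dilateM => x Mx.
  have pd0 : (p : K) * d != 0 by rewrite mulf_neq0.
  exists (((p : K) * d)^-1 *: x); last by rewrite scalerA divff // scale1r.
  apply: latZ Mx; rewrite unfold_in /integer_pred /val_ge.
  by rewrite dvalV // dvalM // dval_unif oppr_ge0 addrC vd orbT.
rewrite NE; apply/seteqP; split=> [x Mx|].
  exists (d^-1 *: x); last by rewrite scalerA divff // scale1r.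
  by apply: latZ Mx; rewrite unfold_in /integer_pred /val_ge dvalV // vd0 orbT.
by apply: dilateS; rewrite unfold_in /integer_pred /val_ge vd0 orbT.
Qed.

(* The default value L is never used when V is nonzero and x is in Xmax: see
   class_repP below for existence and class_rep_uniq for uniqueness. *)
Definition class_rep (L : stable_lattice) (x : set stable_lattice) :
    stable_lattice :=
  xget L [set M | [/\ x M, (L : set V) `<=` M
                    & ~ ((L : set V) `<=` dilate p M)]].

Lemma class_rep_sub (L : stable_lattice) x : (L : set V) `<=` class_rep L x.
Proof. by rewrite /class_rep; case: xgetP => [M _ []|_]. Qed.

Lemma class_repP (L : stable_lattice) x : (exists w : V, w != 0) -> Xmax x ->
  [/\ x (class_rep L x), (L : set V) `<=` class_rep L x
    & ~ ((L : set V) `<=` dilate p (class_rep L x))].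
Proof.
move=> V0 [M _ <-]; rewrite /class_rep; case: xgetP => [N _ //|none].
by have [N /none] := class_rep_ex L M V0.
Qed.

Definition theta (L : stable_lattice) (x : set stable_lattice) :
    subrepresentation (lat_mod_rep L) * subrepresentation (lat_mod_rep L) :=
  let phi := lat_mod_incl (@class_rep_sub L x) in
  (inter_ker phi, inter_preim phi (socle (lat_mod_rep (class_rep L x)))).

End Lattices.

Arguments Xmax {K v} p {V G} rho.

(* Main.v *)
Require Import Defs.
From mathcomp Require Import all_boot all_order all_algebra.
From mathcomp Require Import boolp classical_sets functions.
From mathcomp Require Import ring.

(* For N maximal with respect to w, every nonzero subrepresentation W of N/pN
   contains the class of w: otherwise p^-1 times the preimage of W would be a
   larger lattice normalised at w.  Hence soc(N/pN) is irreducible and is the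
   smallest nonzero subrepresentation, and pulling it back along
   L/pL -> N/pN gives a sharp subquotient.

   Conversely, let (V1, V2) be sharp in L/pL and let w in L reduce to an element
   of V2 \ V1.  Then p^-1 times the preimage of V1 is normalised at w, so by Zorn
   it lies in some M maximal with respect to w.  The kernel of L/pL -> M/pM
   contains V1 but not the class of w, so it equals V1 by sharpness, and V1
   determines V2.

   Zorn applies because an O-submodule of V spanning V and containing no K-line
   is a lattice (this needs completeness), and the vectors whose K-line lies in
   the union of a chain form a subrepresentation, which is zero by
   irreducibility since the union does not contain p^-1 w. *)

Set Implicit Arguments.
Unset Strict Implicit.
Unset Printing Implicit Defensive.

Import Order.TTheory GRing.Theory Num.Theory.

Local Open Scope ring_scope.
Local Open Scope classical_set_scope.

#[local] Obligation Tactic := idtac.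

(** * A criterion for an O-submodule of V to be a lattice, by completeness *)

Section Criterion.
Variables (K : fieldType) (v : discrete_valuation K) (p : uniformiser v).

Lemma dvalX x k : x != 0 -> v (x ^+ k) = v x *+ k.
Proof.
move=> x0; elim: k => [|k IH]; first by rewrite expr0 dval1.
by rewrite exprS dvalM ?expf_neq0 // IH mulrS.
Qed.

Lemma val_geX_unif k : val_ge v k%:Z ((p : K) ^+ k).
Proof. by rewrite /val_ge dvalX ?unif_neq0 // dval_unif pmulrn intz lexx orbT. Qed.

Lemma val_geXV_unif k : val_ge v (- k%:Z) ((p : K) ^- k).
Proof.
rewrite /val_ge dvalV ?expf_neq0 ?unif_neq0 // dvalX ?unif_neq0 //.
by rewrite dval_unif pmulrn intz lexx orbT.
Qed.

Lemma val_ge_trans m n x : n <= m -> val_ge v m x -> val_ge v n x.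
Proof. by rewrite /val_ge => nm /orP[->//|mx]; rewrite (le_trans nm mx) orbT. Qed.

Lemma mulrX_unif_integer c : exists k, c * (p : K) ^+ k \in integer_pred v.
Proof.
have [->|c0] := eqVneq c 0; first by exists 0%N; rewrite mul0r rpred0.
exists `|v c|%N; apply: (@val_ge_trans (v c + `|v c|%N%:Z)).
  by rewrite abszE -lerBlDl sub0r -normrN ler_norm.
by apply: val_geM (val_geX_unif _); rewrite /val_ge lexx orbT.
Qed.

Hypothesis v_complete : complete_valuation v.

(* [s k] is the tail sum of [p ^+ (l - k) * c l] over [l >= k]. *)
Lemma integer_series (c : nat -> K) : (forall k, c k \in integer_pred v) ->
  exists s : nat -> K, forall k,
    s k \in integer_pred v /\ s k = c k + (p : K) * s k.+1.
Proof.
move=> Oc; pose P k := \sum_(l < k) (p : K) ^+ l * c l.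
have PB k i : val_ge v k%:Z (P (k + i)%N - P k).
  elim: i => [|i IH]; first by rewrite addn0 subrr val_ge0.
  rewrite addnS {1}/P big_ord_recr /= -/(P (k + i)%N) addrAC val_geD //.
  rewrite -[k%:Z]addr0; apply: val_geM (Oc _).
  by apply: val_ge_trans (val_geX_unif _); rewrite lez_nat leq_addr.
have cP : cauchy_seq v P.
  move=> n; exists `|n|%N => i j ni nj.
  have -> : P i - P j = (P i - P `|n|%N) - (P j - P `|n|%N).
    by rewrite opprB addrA subrK.
  apply: (@val_ge_trans `|n|%N); first by rewrite abszE ler_norm.
  by apply: val_geB; [rewrite -(subnKC ni)|rewrite -(subnKC nj)]; apply: PB.
have [S PS] := v_complete cP.
(* The bound [PB] survives the limit: compare [S] and [P k] through a term of index beyond both [k]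
   and [j]. *)
have SB k : val_ge v k%:Z (S - P k).
  have [j Pj] := PS k%:Z; have := Pj (k + j)%N (leq_addl _ _).
  by move/(val_geB (PB k j)); rewrite opprB addrC addrA subrK.
exists (fun k => (S - P k) / (p : K) ^+ k) => k; have p0 := unif_neq0 p.
split.
  apply: (@val_ge_trans (k%:Z - k%:Z)); first by rewrite subrr.
  exact: val_geM (val_geXV_unif k).
have pk0 : (p : K) ^+ k != 0 by rewrite expf_neq0.
rewrite {2}/P big_ord_recr /= -/(P k) exprS.
by field; rewrite p0 pk0.
Qed.

Variable V : vectType K.

Section Submodule.
Variable U : set V.
Hypothesis U0 : U 0.
Hypothesis UD : forall x y, U x -> U y -> U (x + y).
Hypothesis UZ : forall a x, a \in integer_pred v -> U x -> U (a *: x).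
Hypothesis U_span : forall x, exists2 c : K, c != 0 & U (c *: x).
Hypothesis U_nodiv : forall x, (forall c : K, U (c *: x)) -> x = 0.

Local Notation n := (\dim {:V}).
Local Notation co := (coord (vbasis {:V})).

Let UB x y : U x -> U y -> U (x - y).
Proof.
move=> Ux Uy; rewrite -scaleN1r; apply/UD/UZ => //.
by rewrite rpredN rpred1.
Qed.

(** A decreasing filtration from U at [m = 0] to zero at [m = n]; coordinate [m] embeds each
    successive quotient into K. *)
Let tail m x := U x /\ forall j : 'I_n, (j < m)%N -> co j x = 0.

(** Coordinate [i] of a pivot generates the O-module of all [i]-th coordinates of [tail i], so
    pivots at every level form an echelon basis. *)
Let pivot (i : 'I_n) y := [/\ tail i y, co i y != 0
  & forall x, tail i x -> co i x / co i y \in integer_pred v].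

(* Vanishing of Ext^1(K, tail m): every extension of K by [tail m] splits. *)
Let cotorsion m := forall d, (forall k : nat, tail m (d k)) ->
  exists t, forall k, tail m (t k) /\ t k = d k + (p : K) *: t k.+1.

Let tail_elim (i : 'I_n) y x : pivot i y -> tail i x ->
  tail i.+1 (x - (co i x / co i y) *: y).
Proof.
move=> [[Uy ty] y0 Py] tx; have [Ux tx0] := tx; split.
  by apply/UB/UZ => //; apply: Py.
move=> j; rewrite ltnS leq_eqVlt linearB linearZ /= => /orP[/eqP/val_inj->|ji].
  by rewrite divfK // subrr.
by rewrite (tx0 _ ji) (ty _ ji) mulr0 subrr.
Qed.

Let tail_n x : tail n x -> x = 0.
Proof.
move=> [_ x0]; rewrite (coord_vbasis (memvf x)) big1 // => i _.
by rewrite x0 ?scale0r.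
Qed.

(* The coordinates of [tail i] form an O-submodule of K: it is a fractional
   ideal, or all of K and then cotorsion of [tail i.+1] lifts a line into U. *)
Let pivot_ex (i : 'I_n) : cotorsion i.+1 -> exists y, pivot i y.
Proof.
move=> ct; have p0 := unif_neq0 p.
have [c c0 Uc] := U_span (vbasis {:V})`_i.
have cE j : co j (c *: (vbasis {:V})`_i) = c * (i == j)%:R.
  by rewrite linearZ /= coord_free ?(basis_free (vbasisP _)).
have tc : tail i (c *: (vbasis {:V})`_i).
  split=> // j ji; rewrite cE.
  by rewrite eq_sym -val_eqE ltn_eqF ?mulr0.
have [[B minB]|unb] := pselect (exists B : int,
    forall x, tail i x -> co i x != 0 -> B <= v (co i x)).
  (* The least valuation is sought as a natural-number offset from the lower bound [B]; an element
     attaining it is a pivot. *)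
  pose P k := `[< exists x, [/\ tail i x, co i x != 0 & v (co i x) = B + k%:Z] >].
  have exP : exists k, P k.
    have c0' : co i (c *: (vbasis {:V})`_i) != 0 by rewrite cE eqxx mulr1.
    exists `|v (co i (c *: (vbasis {:V})`_i)) - B|%N; apply/asboolP.
    exists (c *: (vbasis {:V})`_i); split=> //.
    by rewrite gez0_abs ?subr_ge0 ?minB // addrCA subrr addr0.
  case: (ex_minnP exP) => k /asboolP[y [ty y0 vy]] mink; exists y; split=> // x tx.
  have [->|x0] := eqVneq (co i x) 0; first by rewrite mul0r rpred0.
  rewrite unfold_in /integer_pred /val_ge dvalM ?invr_eq0 // dvalV // subr_ge0.
  rewrite vy -lerBrDl -[_ - B]gez0_abs ?subr_ge0 ?minB // lez_nat mink ?orbT //.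
  apply/asboolP; exists x; split=> //.
  by rewrite gez0_abs ?subr_ge0 ?minB // addrCA subrr addr0.
(* Without a lower bound every [p ^- k] occurs as an [i]-th coordinate, by rescaling an element of
   smaller valuation. *)
have /choice[u uP] : forall k, exists x, tail i x /\ co i x = (p : K) ^- k.
  move=> k; have [x [tx [x0 vx]]] :
      exists x, tail i x /\ (co i x != 0 /\ v (co i x) <= - k%:Z).
    apply: contrapT => nx; apply: unb; exists (- k%:Z) => x tx x0.
    by case: leP => // vx; case: nx; exists x; split=> //; split=> //; apply: ltW.
  have [Ux tx0] := tx.
  exists (((p : K) ^- k / co i x) *: x); split; last by rewrite linearZ /= divfK.
  split; last by move=> j ji; rewrite linearZ /= (tx0 _ ji) mulr0.
  apply: UZ => //; apply: (@val_ge_trans (- k%:Z + - v (co i x))).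
    by rewrite subr_ge0.
  apply: val_geM; first exact: val_geXV_unif.
  by rewrite /val_ge dvalV // lexx orbT.
(* The [i]-th coordinates cancel here, so the differences lie in [tail i.+1], and the resulting [t]
   corrects [u] to a sequence with [w k = p *: w k.+1]. *)
have [|t tP] := ct (fun k => (p : K) *: u k.+1 - u k).
  move=> k; have [[Uk tk] uk] := uP k; have [[Uk1 tk1] uk1] := uP k.+1; split.
    by apply: UB => //; apply: UZ => //; apply: unif_integer.
  move=> j; rewrite ltnS leq_eqVlt linearB linearZ /= => /orP[/eqP/val_inj->|ji].
    by rewrite uk uk1 exprS invfM mulVKf ?subrr.
  by rewrite (tk _ ji) (tk1 _ ji) mulr0 subrr.
pose w k := u k + t k.
have Uw k : U (w k) by apply: UD; [have [[]] := uP k|have [[]] := tP k].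
have wS k : w k = (p : K) *: w k.+1.
  by rewrite /w; have [_ ->] := tP k; rewrite addrA addrCA subrr addr0 scalerDr.
have w0E k : w 0%N = (p : K) ^+ k *: w k.
  elim: k => [|k ->]; first by rewrite expr0 scale1r.
  by rewrite [w k]wS scalerA exprSr.
(* Any scalar times [w 0] is an integral multiple of some [w k], so the whole line lies in U; yet
   coordinate [i] of [w 0] is 1. *)
have w00 : w 0%N = 0.
  apply: U_nodiv => a; have [k ak] := mulrX_unif_integer a.
  by rewrite (w0E k) scalerA; apply: UZ.
have [[_ t0] _] := tP 0%N; have [_ u0] := uP 0%N.
have : co i (w 0%N) = 1 by rewrite linearD /= u0 t0 ?ltnSn // expr0 invr1 addr0.
by rewrite w00 linear0 => /esym/eqP; rewrite oner_eq0.
Qed.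

(** A pivot splits [tail i] as [O y] plus [tail i.+1]. The recursion is solved separately on each
    summand, on the first by [integer_series]. *)
Let cotorsionP (i : 'I_n) y : pivot i y -> cotorsion i.+1 -> cotorsion i.
Proof.
move=> Py ct d td; have [[Uy ty] y0 Oy] := Py.
have [s sP] := integer_series (fun k => Oy _ (td k)).
have [t tP] := ct _ (fun k => tail_elim Py (td k)).
exists (fun k => s k *: y + t k) => k; have [Os sE] := sP k.
have [[Ut t0] tE] := tP k; split; [split|].
- by apply: UD => //; apply: UZ.
- move=> j ji; rewrite linearD linearZ /= (ty _ ji) t0 ?mulr0 ?addr0 //.
  exact: ltnW.
- rewrite {1}sE {1}tE scalerDl scalerDr scalerA addrACA.
  by congr (_ + _); rewrite addrC subrK.
Qed.

Lemma is_lattice_nodiv : is_lattice v U.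
Proof.
(* Pivots and cotorsion feed each other, so they are built together, downward from [m = n]; [k] is
   the number of levels above [m]. *)
have step k : forall m, (m + k)%N = n ->
    cotorsion m /\ forall i : 'I_n, (m <= i)%N -> exists y, pivot i y.
  elim: k => [|k IH] m.
    rewrite addn0 => ->; split=> [d td|i]; last by rewrite leqNgt ltn_ord.
    exists (fun=> 0) => k; rewrite (tail_n (td k)) scaler0 addr0; split=> //.
    by split=> // j _; rewrite linear0.
  rewrite addnS -addSn => mk; have [ct pv] := IH _ mk.
  have mn : (m < n)%N by rewrite -mk leq_addr.
  have [y Py] := @pivot_ex (Ordinal mn) ct.
  split; first exact: (cotorsionP Py).
  move=> i; rewrite leq_eqVlt => /orP[/eqP mi|/pv//]; exists y.
  by have <- : Ordinal mn = i by apply: val_inj.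
have [_ pv] := step n 0%N (add0n _).
have [e eP] := choice (fun i => pv i (leq0n i)).
exists e; split=> [c ce|].
  have ce0 : \sum_i (\val (c i) : K) *: e i = 0 :> V by [].
  (* The pivots are triangular: coordinate [i] of the relation sees only [e i] once the earlier
     coefficients are known to vanish. *)
  suff c0 m : forall i : 'I_n, (i < m)%N -> c i = 0 by move=> i; apply: (c0 i.+1).
  elim: m => // m IH i; rewrite ltnS leq_eqVlt => /orP[/eqP im|/IH//].
  have := congr1 (co i) ce0; rewrite linear0 linear_sum (bigD1 i) //= big1.
    have [_ e0 _] := eP i; rewrite addr0 linearZ /=.
    by move/eqP; rewrite mulf_eq0 (negPf e0) orbF => /eqP ?; apply: val_inj.
  move=> j ji; rewrite linearZ /=.
  have [lt_ji|ij] := ltnP j i; first by rewrite IH ?mul0r // -im.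
  have [[_ ej] _ _] := eP j; rewrite ej ?mulr0 // ltn_neqAle ij andbT.
  by rewrite eq_sym.
apply/seteqP; split=> [x Ux|_ [c ->]]; last first.
  apply: (big_ind U) => // i _; have [[Ue _] _ _] := eP i.
  by apply: UZ => //; apply: valP.
(* Successive elimination by the pivots, ending at [tail n], which is zero. *)
have span k : forall m y, (m + k)%N = n -> tail m y ->
    exists c : 'I_n -> integer_ring v, y = \sum_i c i *: (e i : restr v V).
  elim: k => [|k IH] m y.
    rewrite addn0 => -> /tail_n->; exists (fun=> 0).
    by rewrite big1 // => i _; rewrite scale0r.
  rewrite addnS -addSn => mk ty; have mn : (m < n)%N by rewrite -mk leq_addr.
  pose i := Ordinal mn; have Pe := eP i; have [_ _ Oe] := Pe.
  have [c yE] := IH m.+1 _ mk (@tail_elim i _ y Pe ty).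
  have [a aE] := integer_predE (Oe y ty).
  (* The induction does not record that [c i] vanishes, so [a] is added to it instead of replacing
     it. *)
  exists (fun j => c j + (if j == i then a else 0)).
  under eq_bigr do rewrite scalerDl.
  rewrite big_split /= -yE (bigD1 i) //= eqxx big1 => [|j /negPf->].
    by rewrite addr0 -aE subrK.
  by rewrite scale0r.
by apply: (span n 0%N x (add0n _)); split.
Qed.

End Submodule.
End Criterion.

(** * Socles with a smallest nonzero subrepresentation, and sharp subquotients *)

Section Sharp.
Variables (G : groupType) (R : pzRingType) (M : lmodType R).
Variable r : representation G M.
Implicit Types W T : subrepresentation r.

Lemma subrep_eq W T : (W : set M) = T -> W = T.
Proof.
case: W T => [W W0 WD WZ WG] [T T0 TD TZ TG] /= WT; subst T.
by congr Subrepresentation; apply: Prop_irrelevance.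
Qed.

Program Definition subrep_bigcap (P : set (subrepresentation r)) :
    subrepresentation r :=
  @Subrepresentation _ _ _ _ [set x | forall W, P W -> subrep_set W x] _ _ _ _.
Next Obligation. by move=> P W _; apply: subrep0. Qed.
Next Obligation.
by move=> P x y Px Py W PW; apply: subrepD; [apply: Px|apply: Py].
Qed.
Next Obligation. by move=> P a x Px W PW; apply/subrepZ/Px. Qed.
Next Obligation. by move=> P g x Px W PW; apply/subrepG/Px. Qed.

Program Definition subrep_img W (T : subrepresentation (sub_rep W)) :
    subrepresentation r :=
  @Subrepresentation _ _ _ _ [set x | exists2 y : subrep_type W, subrep_set T y & \val y = x]
    _ _ _ _.
Next Obligation. by move=> W T; exists 0; first exact: subrep0. Qed.
Next Obligation.
by move=> W T _ _ [x Tx <-] [y Ty <-]; exists (x + y); first exact: subrepD.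
Qed.
Next Obligation.
by move=> W T a _ [x Tx <-]; exists (a *: x); first exact: subrepZ.
Qed.
Next Obligation.
by move=> W T g _ [x Tx <-]; exists (sub_rep W g x); first exact: subrepG.
Qed.

(** Lets irreducibility be tested inside [M], with [subrep_in] and [subrep_img] translating to and
    from the subtype. *)
Lemma irreducible_subP W : irreducible (sub_rep W) <->
  (exists2 x, subrep_set W x & x != 0) /\
  forall T, (T : set M) `<=` W -> (exists2 x, subrep_set T x & x != 0) ->
    (W : set M) `<=` T.
Proof.
split=> [[[x x0] irr]|[[x Wx x0] min]]; split.
- by exists (\val x); [apply/asboolP; apply: (valP x)|].
- move=> T TW [y Ty y0] z Wz.
  pose s x (Wx : subrep_set W x) : subrep_type W := Sub x (asboolT Wx).
  have [T0|TT] := irr (subrep_in T W).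
    have : subrep_set (subrep_in T W) (s y (TW _ Ty)) by [].
    by rewrite T0 => /(congr1 val)/= /eqP; rewrite (negPf y0).
  have : subrep_set (subrep_in T W) (s z Wz) by rewrite TT.
  by [].
- by exists (Sub x (asboolT Wx) : subrep_type W).
- move=> T; have [[y Ty y0]|T0] := pselect (exists2 y, subrep_set T y & y != 0).
    right; apply/seteqP; split=> // z _.
    have [|||y' Ty' /val_inj<-//] := min (subrep_img T) _ _ (\val z).
    + by move=> _ [x' _ <-]; apply/asboolP; apply: (valP x').
    + by exists (\val y); [exists y|].
    + by apply/asboolP; apply: (valP z).
  left; apply/seteqP; split=> [y Ty|_ ->]; last exact: subrep0.
  by apply/eqP/negPn/negP => y0; apply: T0; exists y.
Qed.

Section MinimalSubrep.
Variable u : M.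
Hypothesis u0 : u != 0.
Hypothesis u_min : forall W, (exists2 x, subrep_set W x & x != 0) ->
  subrep_set W u.

(** Each irreducible [S i] meets [W] in a subrepresentation containing [u], hence nonzero, so [S i]
    lies in [W]. *)
Lemma socle_sub W : (exists2 x, subrep_set W x & x != 0) ->
  (socle r : set M) `<=` W.
Proof.
move=> W0 _ [n [S [y [Sy ->]]]].
apply: (big_ind (subrep_set W)); [exact: subrep0|exact: subrepD|move=> i _].
have [/irreducible_subP[S0 Smin] Syi] := Sy i.
pose T := subrep_bigcap [set T | T = S i \/ T = W].
have Tu : exists2 x, subrep_set T x & x != 0.
  by exists u => // Z [] ->; apply: u_min.
have TS : (T : set M) `<=` S i by move=> x; apply; left.
by have := Smin T TS Tu _ Syi; apply; right.
Qed.

(** The intersection of all nonzero subrepresentations contains [u], so it is nonzero and therefore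
    irreducible; [u] is a one-term sum from it. *)
Lemma socle_min : subrep_set (socle r) u.
Proof.
pose S := subrep_bigcap [set W | exists2 x, subrep_set W x & x != 0].
have Su : subrep_set S u by move=> W; apply: u_min.
exists 1%N, (fun=> S), (fun=> u); split=> [_|]; last by rewrite big_ord1.
split=> //; apply/irreducible_subP; split; first by exists u.
by move=> T _ T0 x; apply.
Qed.

End MinimalSubrep.

Program Definition subquo_img W1 W2
    (T : subrepresentation (subquotient_rep W1 W2)) : subrepresentation r :=
  @Subrepresentation _ _ _ _
    [set x | exists2 y : subrep_type W2,
       subrep_set T (quorep_pi (subrep_in W1 W2) y) & \val y = x] _ _ _ _.
Next Obligation. by move=> W1 W2 T; exists 0; rewrite ?raddf0; first exact: subrep0. Qed.
Next Obligation.
move=> W1 W2 T _ _ [x Tx <-] [y Ty <-]; exists (x + y) => //.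
by rewrite raddfD; exact: subrepD.
Qed.
Next Obligation.
move=> W1 W2 T a _ [x Tx <-]; exists (a *: x) => //.
by rewrite -quorep_scaleE; apply: (subrepZ a Tx).
Qed.
Next Obligation.
move=> W1 W2 T g _ [x Tx <-]; exists (sub_rep W2 g x) => //.
by rewrite -quorep_actE; apply: (subrepG g Tx).
Qed.

(** Given the minimality clause, irreducibility reduces to strictness: a nonzero subrepresentation
    of the quotient pulls back strictly above [W1], hence contains [W2]. *)
Lemma sharpP W1 W2 : sharp r (W1, W2) <->
  ((W1 : set M) `<` W2 /\
   forall W, (W1 : set M) `<` W -> (W2 : set M) `<=` W).
Proof.
split=> [[/= W12 [[q q0] _] min]|[W12 min]].
  split=> //; split=> // W21; move/eqP: q0; apply.
  rewrite -[q]quorep_piK -(raddf0 (quorep_pi (subrep_in W1 W2))).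
  apply/quorep_piE; rewrite subr0; apply: W21.
  by apply/asboolP; apply: (valP (repr q : subrep_type W2)).
split=> //=; first by have [] := W12.
have [W1_2 W21] := W12.
split=> [|T].
  have [x W2x W1x] : exists2 x, subrep_set W2 x & ~ subrep_set W1 x.
    apply: contrapT => nx; apply: W21 => x W2x.
    by apply: contrapT => W1x; apply: nx; exists x.
  exists (quorep_pi (subrep_in W1 W2) (Sub x (asboolT W2x) : subrep_type W2)).
  apply/eqP; rewrite -(raddf0 (quorep_pi (subrep_in W1 W2))) => /quorep_piE.
  by rewrite subr0.
have [[q Tq q0]|T0] := pselect (exists2 q, subrep_set T q & q != 0); last first.
  left; apply/seteqP; split=> [q Tq|_ ->]; last exact: subrep0.
  by apply/eqP/negPn/negP => q0; apply: T0; exists q.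
right; apply/seteqP; split=> // z _.
have WT : (W1 : set M) `<` subquo_img T.
  split=> [x W1x|TW1].
    exists (Sub x (asboolT (W1_2 _ W1x)) : subrep_type W2) => //.
    set y := (y in quorep_pi _ y).
    have -> : quorep_pi (subrep_in W1 W2) y = 0.
      by rewrite -(raddf0 (quorep_pi (subrep_in W1 W2))); apply/quorep_piE; rewrite subr0.
    exact: subrep0.
  move/eqP: q0; apply; rewrite -[q]quorep_piK.
  rewrite -(raddf0 (quorep_pi (subrep_in W1 W2))); apply/quorep_piE; rewrite subr0.
  by apply: TW1; exists (repr q : subrep_type W2); rewrite ?quorep_piK.
have [|y Ty /val_inj yz] := min _ WT (\val (repr z : subrep_type W2)).
  by apply/asboolP; apply: (valP (repr z : subrep_type W2)).
by rewrite -[z]quorep_piK -yz.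
Qed.

Lemma sharp_inj W T1 T2 : sharp r (W, T1) -> sharp r (W, T2) -> T1 = T2.
Proof.
move=> /sharpP[WT1 min1] /sharpP[WT2 min2].
by apply/subrep_eq/seteqP; split; [apply: min1|apply: min2].
Qed.

End Sharp.

(** * Pulling the socle back along an intertwiner *)

Section SharpInter.
Variables (G : groupType) (R : pzRingType) (M N : lmodType R).
Variables (r : representation G M) (s : representation G N).
Variable f : intertwiner r s.

Program Definition inter_img (W : subrepresentation r) : subrepresentation s :=
  @Subrepresentation _ _ _ _ (f @` W) _ _ _ _.
Next Obligation. by move=> W; exists 0; [exact: subrep0|exact: linear0]. Qed.
Next Obligation.
move=> W _ _ [x Wx <-] [y Wy <-].
by exists (x + y); [exact: subrepD|rewrite linearD].
Qed.
Next Obligation.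
by move=> W a _ [x Wx <-]; exists (a *: x); [exact: subrepZ|rewrite linearZ].
Qed.
Next Obligation.
by move=> W g _ [x Wx <-]; exists (r g x); [exact: subrepG|rewrite interG].
Qed.

(** A [W] strictly above the kernel has nonzero image, which contains the socle; [W] also contains
    the kernel, so it contains the full preimage of the socle. *)
Lemma sharp_socle_preim (u : N) : u != 0 ->
  (forall W : subrepresentation s, (exists2 x, subrep_set W x & x != 0) ->
     subrep_set W u) ->
  (exists x, f x != 0) ->
  sharp r (inter_ker f, inter_preim f (socle s)).
Proof.
move=> u0 u_min [x fx0].
have fW (W : subrepresentation r) : (inter_ker f : set M) `<` W ->
    exists2 y, subrep_set (inter_img W) y & y != 0.
  move=> [_ Wker]; apply: contrapT => W0; apply: Wker => y Wy /=.
  by apply/eqP/negPn/negP => fy0; apply: W0; exists (f y) => //; exists y.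
apply/sharpP; split; first split.
- move=> y fy; change (subrep_set (socle s) (f y)).
  by rewrite [f y]fy; apply: subrep0.
(* The image of [f] is nonzero, so it contains [u]; a preimage of [u] is in the upper member but not
   in the kernel. *)
- move=> ker; pose T := Subrepresentation (r := r) (subrep_set := setT) I
    (fun _ _ _ _ => I) (fun _ _ _ => I) (fun _ _ _ => I).
  have [|y _ fy] := u_min (inter_img T); first by exists (f x) => //; exists x.
  have : subrep_set (inter_ker f) y.
    by apply: ker; rewrite /= fy; apply: (socle_min u0 u_min).
  by rewrite /= fy => /eqP; rewrite (negPf u0).
move=> W kerW y /= fy; have [z Wz fz] := socle_sub u0 u_min (fW W kerW) fy.
have [kW _] := kerW; rewrite -(subrK z y); apply: subrepD => //.
by apply: kW; rewrite /= linearB fz subrr.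
Qed.

End SharpInter.

(** * Stable lattices, their reductions, and maximality *)

Section StableLattices.
Variables (K : fieldType) (v : discrete_valuation K) (p : uniformiser v).
Hypothesis v_complete : complete_valuation v.
Variables (V : vectType K) (G : groupType) (rho : representation G V).
Implicit Types L M N : stable_lattice v rho.

Let p0 : (p : K) != 0 := unif_neq0 p.

Lemma lat0 L : lat L 0.
Proof. exact: (subrep0 (lat_subrep L)). Qed.

Lemma latD L x y : lat L x -> lat L y -> lat L (x + y).
Proof. exact: (@subrepD _ _ _ _ (lat_subrep L)). Qed.

Lemma latG L g x : lat L x -> lat L (rho g x).
Proof. exact: (@subrepG _ _ _ _ (lat_subrep L)). Qed.

Definition lat_sub L x (Lx : lat L x) : lat_type L := Sub x (asboolT Lx).

Lemma lat_val L (x : lat_type L) : lat L (\val x).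
Proof. by apply/asboolP; apply: (valP x). Qed.

Lemma lat_span L x : exists2 c : K, c != 0 & lat L (c *: x).
Proof.
have [e [free_e LE]] := lat_is_lattice L.
have [c ->] := lattice_coord (lattice_free free_e) x.
have [[i0 ci0]|c0] := pselect (exists i, c i != 0); last first.
  exists 1; rewrite ?oner_eq0 // scale1r big1 => [|i _]; first exact: lat0.
  have [->|ci] := eqVneq (c i) 0; first by rewrite scale0r.
  by case: c0; exists i.
have [i ci Oc] := @min_scale _ v _ c i0 ci0.
exists (c i)^-1; first by rewrite invr_eq0.
rewrite LE; have [b bE] := choice (fun j => integer_predE (Oc j)).
exists b; rewrite scaler_sumr; apply: eq_bigr => j _.
by rewrite scalerA mulrC -bE.
Qed.

Lemma lat_nodiv L x : (forall c : K, lat L (c *: x)) -> x = 0.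
Proof.
have [e [free_e LE]] := lat_is_lattice L; have Ke := lattice_free free_e.
have [c ->] := lattice_coord Ke x.
move=> Lx; apply: big1 => i _; have [->|ci] := eqVneq (c i) 0.
  by rewrite scale0r.
(* This scalar turns the [i]-th coefficient into [p^-1], which is not integral. *)
have := Lx ((p : K)^-1 / c i); rewrite LE => -[b /eqP].
rewrite -subr_eq0 scaler_sumr -sumrB => /eqP bE.
have /Ke/(_ i)/eqP : \sum_j ((p : K)^-1 / c i * c j - \val (b j)) *: (e j : V) = 0.
  by rewrite -[RHS]bE; apply: eq_bigr => j _; rewrite scalerBl scalerA.
rewrite divfK // subr_eq0 => /eqP pb.
have := valP (b i); rewrite -pb unfold_in /integer_pred /val_ge invr_eq0.
by rewrite (negPf p0) dvalV // dval_unif.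
Qed.

Lemma stable_lattice_ex (U : set V) : U 0 ->
  (forall x y, U x -> U y -> U (x + y)) ->
  (forall a x, a \in integer_pred v -> U x -> U (a *: x)) ->
  (forall g x, U x -> U (rho g x)) ->
  (forall x, exists2 c : K, c != 0 & U (c *: x)) ->
  (forall x, (forall c : K, U (c *: x)) -> x = 0) ->
  exists M : stable_lattice v rho, (M : set V) = U.
Proof.
move=> U0 UD UZ UG Us Und.
have UL := is_lattice_nodiv p v_complete U0 UD UZ Us Und.
suff Ust g : rho g @` U = U by exists (StableLattice UL Ust).
apply/seteqP; split=> [_ [x Ux <-]|x Ux]; first exact: UG.
exists (rho g^-1%g x); first exact: UG.
by rewrite -repM mulgV rep1.
Qed.

Lemma dilateP (c : K) (A : set V) x : c != 0 -> dilate c A x <-> A (c^-1 *: x).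
Proof.
move=> c0; split=> [[y Ay <-]|Ax]; first by rewrite scalerA mulVf // scale1r.
by exists (c^-1 *: x) => //; rewrite scalerA divff // scale1r.
Qed.

Lemma lat_red_eq0 L (x : lat_type L) : red p x = 0 <-> dilate p L (\val x).
Proof.
rewrite -(raddf0 (@red _ v p (lat_type L))); split=> [/redE[z]|[y Ly yx]].
  rewrite subr0 => ->.
  by exists (\val z) => //; apply: lat_val.
apply/redE; exists (lat_sub Ly).
by apply/val_inj; rewrite subr0; apply/esym.
Qed.

Lemma normalisedP L w : normalised p L w <-> lat L w /\ ~ dilate p L w.
Proof.
split=> [[x [<- /eqP rx]]|[Lw pLw]].
  by split; [apply: lat_val|move/lat_red_eq0].
exists (lat_sub Lw); split=> //.
by apply/eqP => /lat_red_eq0.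
Qed.

(** [M] is [p^-1] times the preimage of [W]. It lies between [L], which makes it span, and [p^-1 L],
    which keeps K-lines out. *)
Lemma preimage_lattice L (W : subrepresentation (lat_mod_rep p L)) :
  exists2 M : stable_lattice v rho, (L : set V) `<=` M
    & forall x : lat_type L, dilate p M (\val x) <-> subrep_set W (red p x).
Proof.
pose U : set V :=
  [set y | exists2 z : lat_type L, subrep_set W (red p z) & (p : K) *: y = \val z].
have LU : (L : set V) `<=` U.
  move=> y Ly; have pLy : lat L ((p : K) *: y) by apply: latZ => //; apply: unif_integer.
  exists (lat_sub pLy) => //.
  set z := (z in red p z); have -> : red p z = 0 by apply/lat_red_eq0; exists y.
  exact: subrep0.
have [||||||M ME] := @stable_lattice_ex U.
- exact/LU/lat0.
- move=> x y [z Wz xz] [t Wt yt]; exists (z + t); last by rewrite scalerDr xz yt.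
  by rewrite raddfD; apply: subrepD.
- move=> a x /integer_predE[b <-] [z Wz xz]; exists (b *: z).
    by rewrite -red_scaleE; apply: (subrepZ (residue b) Wz).
  by rewrite scalerA mulrC -scalerA xz.
- move=> g x [z Wz xz]; exists (lat_rep L g z).
    by have := subrepG g Wz; rewrite /= red_mapE.
  by rewrite -linearZ xz.
- by move=> x; have [c c0 Lc] := lat_span L x; exists c => //; apply: LU.
- move=> x Ux; apply: (@lat_nodiv L) => c; have [z _] := Ux (c / (p : K)).
  rewrite scalerA mulrC divfK // => ->.
  exact: lat_val.
exists M => [|x]; rewrite ME // dilateP //; split=> [[z Wz]|Wx].
  by rewrite scalerA divff // scale1r => /val_inj->.
by exists x => //; rewrite scalerA divff // scale1r.
Qed.

Lemma maximal_wrt_min N (x : lat_type N) (W : subrepresentation (lat_mod_rep p N)) :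
  maximal_wrt p (\val x) N -> (exists2 q, subrep_set W q & q != 0) ->
  subrep_set W (red p x).
Proof.
move=> [/normalisedP[Nx _] maxN] [q Wq q0]; apply: contrapT => Wx.
have [M NM ME] := preimage_lattice W.
have MN : (M : set V) = N.
  apply: maxN => //; apply/normalisedP; split; first exact: NM.
  by move/ME.
move/eqP: q0; apply; rewrite -[q]redK; apply/lat_red_eq0.
(* Once [M = N], the equivalence [ME] says that [W] contains only the zero class. *)
by rewrite -MN; apply/ME; rewrite redK.
Qed.

Lemma maximal_wrt_ex N w : irreducible rho -> normalised p N w ->
  exists2 M : stable_lattice v rho, (N : set V) `<=` M & maximal_wrt p w M.
Proof.
move=> irr nN; pose P M := (N : set V) `<=` M /\ normalised p M w.
pose T := {M | P M}.
pose R : rel T := fun X Y => `[< (sval X : set V) `<=` sval Y >].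
have [| | | |X maxX] := @Zorn T R.
- by move=> X; apply/asboolP.
- by move=> X Y Z /asboolP XY /asboolP YZ; apply/asboolP; apply: subset_trans YZ.
- move=> [X PX] [Y PY] /asboolP XY /asboolP YX.
  have eXY : X = Y by apply: stable_lattice_eq; apply/seteqP.
  by subst Y; congr exist; apply: Prop_irrelevance.
- move=> A totA.
  (* The empty chain is bounded by [N] itself. *)
  have [[X0 AX0]|A0] := pselect (exists X, A X); last first.
    by exists (exist P N (conj (@subset_refl _ _) nN)) => X AX; case: A0; exists X.
  pose U : set V := [set x | exists2 X, A X & lat (sval X) x].
  have NU : (N : set V) `<=` U.
    by move=> x Nx; exists X0 => //; have [NX _] := svalP X0; apply: NX.
  (* Used twice: it rules out that every K-line lies in U, and it shows that the union is still
     normalised at [w]. *)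
  have Uw : ~ U ((p : K)^-1 *: w).
    move=> [X AX]; have [_ /normalisedP[_ Xw]] := svalP X.
    by move/(dilateP _ _ p0).
  have U0 : U 0 by exact/NU/lat0.
  have UD x y : U x -> U y -> U (x + y).
    move=> [X AX Xx] [Y AY Yy]; have [/asboolP XY|/asboolP YX] := totA X Y AX AY.
      by exists Y => //; apply: latD => //; apply: XY.
    by exists X => //; apply: latD => //; apply: YX.
  have UG g x : U x -> U (rho g x) by move=> [X AX Xx]; exists X => //; apply: latG.
  have [|||M MU] := @stable_lattice_ex U U0 UD _ UG.
  + by move=> a x Oa [X AX Xx]; exists X => //; apply: latZ.
  + by move=> x; have [c c0 Lc] := lat_span N x; exists c => //; apply: NU.
  + pose D : set V := [set x | forall c : K, U (c *: x)].
    have D0 : D 0 by move=> c; rewrite scaler0.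
    have DD x y : D x -> D y -> D (x + y) by move=> Dx Dy c; rewrite scalerDr; apply: UD.
    have DZ a x : D x -> D (a *: x) by move=> Dx c; rewrite scalerA.
    have DG g x : D x -> D (rho g x) by move=> Dx c; rewrite -linearZ; apply: UG.
    move=> x; have [_ /(_ (Subrepresentation D0 DD DZ DG))[/= DE|/= DE]] := irr.
      by move=> Ux; have : D x by []; rewrite DE.
    by have : D w by [rewrite DE]; move/(_ (p : K)^-1).
  have PM : P M.
    split; rewrite ?MU //; apply/normalisedP; rewrite MU dilateP //; split=> //.
    by apply: NU; have /normalisedP[] := nN.
  by exists (exist P M PM) => X AX; apply/asboolP => x Xx; rewrite /= MU; exists X.
have [NX nX] := svalP X; exists (sval X) => //; split=> // M nM XM.
have PM : P M by split=> //; apply: subset_trans XM.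
by have <- : exist P M PM = X by apply: maxX; apply/asboolP.
Qed.

(** Scaling by [c] carries maximality at [w] to maximality at [c *: w]. This transfers maximality to
    the member of the class picked by [class_rep]. *)
Lemma maximal_homothety M N : maximal p M -> homothety_class M N -> maximal p N.
Proof.
move=> [w [w0 [/normalisedP[Mw pMw] maxM]]] [c [c0 NE]].
have c0' : c^-1 != 0 by rewrite invr_eq0.
have cK x : c^-1 *: (c *: x) = x by rewrite scalerA mulVf // scale1r.
have pcK x : (p : K)^-1 *: (c *: x) = c *: ((p : K)^-1 *: x).
  by rewrite !scalerA mulrC.
exists (c *: w); split; first by rewrite scaler_eq0 negb_or c0.
split=> [|M' /normalisedP[Mw' pMw'] NM'].
  apply/normalisedP; rewrite NE dilateP // dilateP // dilateP // cK; split=> //.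
  by rewrite pcK cK -dilateP.
suff MM : (dilate_lattice c0' M' : set V) = M.
  by rewrite NE -MM /= dilateM divff //; apply/seteqP; split=> x;
    rewrite dilateP ?oner_eq0 // invr1 scale1r.
apply: maxM => [|x Mx].
  apply/normalisedP; rewrite /= dilateP // dilateP // dilateP // invrK; split=> //.
  by rewrite -pcK -dilateP.
rewrite /= dilateP // invrK; apply: NM'.
by rewrite NE; exists x.
Qed.

Lemma maximal_sharp L N (LN : (L : set V) `<=` N) : maximal p N ->
  ~ ((L : set V) `<=` dilate p N) ->
  sharp (lat_mod_rep p L)
    (inter_ker (lat_mod_incl p LN),
     inter_preim (lat_mod_incl p LN) (socle (lat_mod_rep p N))).
Proof.
move=> [w [_ maxN]] LpN; have [[x [xw x0]] _] := maxN.
apply: (sharp_socle_preim x0) => [W|].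
  by apply: maximal_wrt_min; rewrite xw.
have [y Ly pNy] : exists2 y, lat L y & ~ dilate p N y.
  apply: contrapT => ny; apply: LpN => y Ly.
  by apply: contrapT => pNy; apply: ny; exists y.
exists (red p (lat_sub Ly)).
by rewrite /= red_mapE; apply/eqP => /lat_red_eq0.
Qed.

(** [theta] carries its own inclusion proof; proof irrelevance allows any other one, so that [N] may
    be a concrete lattice. *)
Lemma thetaE L x N (LN : (L : set V) `<=` N) : class_rep p L x = N ->
  theta p L x = (inter_ker (lat_mod_incl p LN),
                 inter_preim (lat_mod_incl p LN) (socle (lat_mod_rep p N))).
Proof.
move=> xN; subst N; rewrite /theta.
by rewrite (Prop_irrelevance LN (@class_rep_sub _ _ p _ _ _ L x)).
Qed.

End StableLattices.

(** * Values of [theta] are sharp, and every sharp subquotient is a value *)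

Theorem theorem3p12 (K : fieldType) (v : discrete_valuation K)
    (v_complete : complete_valuation v) (pi : uniformiser v)
    (G : groupType) (V : vectType K) (rho : representation G V)
    (rho_irr : irreducible rho) (L : stable_lattice v rho) :
  set_fun (Xmax pi rho) (sharp (lat_mod_rep pi L)) (theta pi L) /\
  set_surj (Xmax pi rho) (sharp (lat_mod_rep pi L)) (theta pi L).
Proof.
have V0 : exists w : V, w != 0 by have [] := rho_irr.
split=> [x Xx|[V1 V2] shV].
  have [xN LN LpN] := class_repP L V0 Xx.
  rewrite (thetaE LN) //; apply: maximal_sharp => //.
  by case: Xx xN => M maxM <-; apply: maximal_homothety.
have [[V12 V21] V2min] := (sharpP _ _).1 shV.
have [q V2q V1q] : exists2 q, subrep_set V2 q & ~ subrep_set V1 q.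
  apply: contrapT => nq; apply: V21 => q V2q.
  by apply: contrapT => V1q; apply: nq; exists q.
pose w : lat_type L := repr q.
have Lw := lat_val w.
have [N LN NE] := preimage_lattice v_complete V1.
have nN : normalised pi N (\val w).
  apply/normalisedP; split; first exact: LN.
  by move/NE; rewrite redK.
have [M NM maxM] := maximal_wrt_ex v_complete rho_irr nN.
have [/normalisedP[_ pMw] _] := maxM.
have LM : (L : set V) `<=` M by apply: subset_trans NM.
have LpM : ~ ((L : set V) `<=` dilate pi M) by move/(_ _ Lw).
have maxM' : maximal pi M.
  exists (\val w); split=> //; apply/eqP => w0; apply: pMw.
  by exists 0; rewrite ?scaler0 //; apply: lat0.
have XM : Xmax pi rho (homothety_class M) by exists M.
exists (homothety_class M) => //.
have [xR LR LpR] := class_repP L V0 XM.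
(* [M] contains [L], and [w] witnesses that [L] is not inside [pi M], so uniqueness identifies [M]
   with the chosen representative. *)
have RE : class_rep pi L (homothety_class M) = M.
  by apply/esym; apply: (class_rep_uniq xR LM LpM LR LpR).
rewrite (thetaE LM RE); have shM := maximal_sharp v_complete LM maxM' LpM.
suff kerE : inter_ker (lat_mod_incl pi LM) = V1.
  by move: shM; rewrite kerE => shM; rewrite (sharp_inj shM shV).
(* A class in [V1] lifts to an element of [pi N], which lies in [pi M]. *)
have V1ker : (V1 : set _) `<=` inter_ker (lat_mod_incl pi LM).
  move=> y; rewrite -[y]redK => /NE pNy /=; rewrite red_mapE.
  apply/lat_red_eq0; case: pNy => z Nz zy; exists z => //.
  exact: NM.
(* A kernel strictly above [V1] would contain [V2] and hence the class [q] of [w], although [w] is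
   not in [pi M]. *)
apply/subrep_eq/seteqP; split=> // y ky; apply: contrapT => V1y.
have : subrep_set (inter_ker (lat_mod_incl pi LM)) q.
  by apply: V2min V2q; split=> // kV1; apply/V1y/kV1.
by rewrite -[q]redK /= red_mapE => /lat_red_eq0.
Qed.
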